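(* Let $\mathfrak{E},\mathfrak{H},\mathfrak{K}$ be Hilbert spaces, let $A\in\mathbf{B}(\mathfrak{E},\mathfrak{H})$ and $B\in\mathbf{B}(\mathfrak{E},\mathfrak{K})$, and let $L(A,B)=\{\{Af,Bf\}:f\in\mathfrak{E}\}$. Then the following statements are equivalent: (i) $B$ is almost dominated by $A$; (ii) $\mathfrak{D}(A,B)=\{k\in\mathfrak{K}:B^*k\in\operatorname{ran}A^*\}$ is dense in $\mathfrak{K}$; (iii) $L(A,B)$ is regular.
   Context: $\mathbf{B}(\mathfrak{X},\mathfrak{Y})$ denotes the everywhere defined bounded linear operators from the Hilbert space $\mathfrak{X}$ to the Hilbert space $\mathfrak{Y}$. A linear relation from $\mathfrak{H}$ to $\mathfrak{K}$ is a linear subspace of $\mathfrak{H}\times\mathfrak{K}$, with elements written $\{f,g\}$. A linear relation is regular if its closure in $\mathfrak{H}\times\mathfrak{K}$ is (the graph of) an operator, i.e. if it is a closable operator. $B$ is almost dominated by $A$ if there exist Hilbert spaces $\mathfrak{K}_n$, operators $B_n\in\mathbf{B}(\mathfrak{E},\mathfrak{K}_n)$ and numbers $c_n\ge0$ such that for all $f\in\mathfrak{E}$: (a) $\|B_nf\|\le c_n\|Af\|$; (b) $\|B_nf\|\le\|B_{n+1}f\|$; (c) $\|B_nf\|\nearrow\|Bf\|$. *)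

(* Defs.v *)
From HB Require Import structures.
From mathcomp Require Import all_boot all_order all_algebra.
From mathcomp Require Import sesquilinear complex.
From mathcomp Require Import all_classical all_reals all_analysis.

Set Implicit Arguments.
Unset Strict Implicit.
Unset Printing Implicit Defensive.

Import Order.TTheory GRing.Theory Num.Theory.
Import numFieldNormedType.Exports.

Local Open Scope classical_set_scope.
Local Open Scope ring_scope.

(* The inner product is linear in its first argument and conjugate-linear in
   its second one. Complex Hilbert spaces are the instances C := R[i], R a
   realType; norms take their (real, nonnegative) values in C. *)
HB.mixin Record CompleteNormedModule_isHilbert (C : numClosedFieldType) V
    of CompleteNormedModule C V := {
  inner : {dot V for Num.conj} ;
  sqr_normE : forall x : V, `|x| ^+ 2 = inner x x }.

#[short(type="hilbertType")]
HB.structure Definition Hilbert (C : numClosedFieldType) :=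
  {V of CompleteNormedModule C V & CompleteNormedModule_isHilbert C V}.

Notation "'[ x , y ]" := (inner x y) : ring_scope.

Section Operators.
Variable C : numClosedFieldType.

Definition bounded_operator (X Y : hilbertType C) (T : {linear X -> Y}) : Prop :=
  exists c : C, forall x, `|T x| <= c * `|x|.

(* For T bounded, the x selected here exists by the Riesz representation
   theorem and is unique; the default value 0 is then irrelevant. *)
Definition adjoint (X Y : hilbertType C) (T : {linear X -> Y}) (y : Y) : X :=
  xget 0 [set x : X | forall f : X, '[T f, y] = '[f, x]].

(* C-valued norms are compared in the partial order of C, so 0 <= c n also
   says that c n is real. *)
Definition almost_dominated (E H K : hilbertType C)
    (A : {linear E -> H}) (B : {linear E -> K}) : Prop :=
  exists (K_ : nat -> hilbertType C) (B_ : forall n, {linear E -> K_ n})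
      (c : nat -> C),
    [/\ forall n, bounded_operator (B_ n),
        forall n, 0 <= c n
      & forall f : E,
        [/\ forall n, `|B_ n f| <= c n * `|A f|,
            forall n, `|B_ n f| <= `|B_ n.+1 f|
          & (fun n => `|B_ n f|) @ \oo --> `|B f|]].

Definition adjoint_domain (E H K : hilbertType C)
    (A : {linear E -> H}) (B : {linear E -> K}) : set K :=
  [set k | range (adjoint A) (adjoint B k)].

Definition linear_relation (H K : hilbertType C) (L : set (H * K)) : Prop :=
  L 0 /\ forall (a : C) (u v : H * K), L u -> L v -> L (a *: u + v).

Definition operator_graph (H K : hilbertType C) (L : set (H * K)) : Prop :=
  linear_relation L /\
  forall (h : H) (k k' : K), L (h, k) -> L (h, k') -> k = k'.

(* The library norms H * K by the maximum of the two norms; it induces the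
   same topology, hence the same closure, as the Hilbert space norm. *)
Definition regular_relation (H K : hilbertType C) (L : set (H * K)) : Prop :=
  operator_graph (closure L).

Definition pair_relation (E H K : hilbertType C)
    (A : {linear E -> H}) (B : {linear E -> K}) : set (H * K) :=
  range (fun f : E => (A f, B f)).

End Operators.

(* Main.v *)
Require Import Defs.
From HB Require Import structures.
From mathcomp Require Import all_boot all_order all_algebra.
From mathcomp Require Import sesquilinear complex.
From mathcomp Require Import all_classical all_reals all_analysis.

Set Implicit Arguments.
Unset Strict Implicit.
Unset Printing Implicit Defensive.

Import Order.TTheory GRing.Theory Num.Theory.
Import numFieldNormedType.Exports.

Local Open Scope classical_set_scope.
Local Open Scope ring_scope.

(** Write L for the relation of the pairs (Af, Bf). Everything is read off
    from inner products: by the Riesz representation theorem, k belongs to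
    D(A, B) exactly when there is h with <Bf, k> = <Af, h> for all f
    ([adjoint_domainP]).

    Regularity of L means that (0, k) in the closure of L forces k = 0
    ([regularP]). If B is almost dominated and Af_j -> 0, Bf_j -> k, then each
    B_n, being dominated by A and contractive with respect to B, satisfies
    |B_n f_i| <= |Bf_i - k|; letting n, then i, go to infinity gives k = 0
    ([almost_dominated_regular]). If D(A, B) is dense, then for d in it
    <k, d> = lim <Bf_j, d> = lim <Af_j, h> = 0, hence k = 0
    ([dense_regular]). If L is regular and k is orthogonal to D(A, B), let
    (b, a) be the component of (k, 0) orthogonal to the pairs (Bg, Ag) in the
    Hilbert sum of K and H. Orthogonality says that b lies in D(A, B), so
    |(b, a)|^2 = <b, k> = 0 and (k, 0) is in the closure of the pairs: k = 0
    ([regular_dense]).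

    What remains is to build the dominated operators when D(A, B) is dense
    ([dense_almost_dominated]). Instead of spectral calculus, one uses the
    parallel sums of B*B and N^2 A*A: the quadratic form
      inf over g of |B(f - g)|^2 + N^2 |Ag|^2
    is increasing in N, at most |Bf|^2 (g = 0) and at most N^2 |Af|^2 (g = f).
    It is the squared distance in the Hilbert sum from (Bf, 0) to the pairs
    (Bg, N Ag), hence equals |B_n f|^2, N = n + 1, for B_n f the component of
    (Bf, 0) orthogonal to these pairs. For d in D(A, B), with h as above, the
    vector (d, -h/N) is orthogonal to the pairs, and it tends to (d, 0); as d
    can be taken close to Bf, the norms |B_n f| tend to |Bf|
    ([dominated_part_ge]).

    The real line enters only in [near_orthogonal], through the infimum of the
    distances to a subspace, and in [near_div_nat], through Archimedes. *)

(** * Dot products and the Hilbert sum *)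

Section DotForm.
Variables (C : numClosedFieldType) (U : lmodType C) (form : {dot U for Num.conj}).

(** The inequality is the positivity of the part w of u orthogonal to v; it is
    proved on an arbitrary module, the spaces below being possibly
    infinite dimensional. *)
Lemma dot_CauchySchwarz (u v : U) :
  `|form u v| ^+ 2 <= form u u * form v v.
Proof.
have [->|v0] := eqVneq v 0.
  by rewrite linear0r normr0 expr0n linear0l mulr0.
have vv : 0 < form v v by rewrite dnorm_gt0.
pose a := form u v / form v v; pose w := u - a *: v.
have wv : form w v = 0.
  by rewrite linearBl/= linearZl_LR/= divfK ?subrr// gt_eqF.
have wav : form w (a *: v) = 0 by rewrite linearZr_LR/= wv mulr0.
have -> : form u u = form w w + `|a| ^+ 2 * form v v.
  by rewrite -dnormZ -hnormDd// subrK.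
rewrite normrM normfV (ger0_norm (ltW vv)) expr_div_n mulrDl -mulrA.
rewrite [X in X * (_ * _)]mulrC -expr2 mulrAC mulVf ?mul1r; last first.
  by rewrite expf_neq0// gt_eqF.
by rewrite lerDr mulr_ge0// dnorm_ge0.
Qed.

Lemma dot_triangle (u v : U) :
  sqrtC (form (u + v) (u + v)) <= sqrtC (form u u) + sqrtC (form v v).
Proof.
have CS : `|form u v| <= sqrtC (form u u) * sqrtC (form v v).
  rewrite -(@ler_pXn2r _ 2)// ?nnegrE ?mulr_ge0 ?sqrtC_ge0 ?dnorm_ge0//.
  by rewrite exprMn !sqrtCK dot_CauchySchwarz.
rewrite -(@ler_pXn2r _ 2)// ?nnegrE ?addr_ge0 ?sqrtC_ge0 ?dnorm_ge0//.
rewrite sqrrD !sqrtCK dnormD addrAC lerD2r lerD2l.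
rewrite -[leLHS](divfK (negbT (pnatr_eq0 C 2))) -ReE mulr_natr lerMn2r/=.
exact: le_trans (leif_Re_Creal _) CS.
Qed.
End DotForm.

Lemma inner_conj (C : numClosedFieldType) (H : hilbertType C) (x y : H) :
  '[x, y] = Num.conj '[y, x].
Proof. by rewrite (hermC inner x y) expr0 mul1r. Qed.

(** A fresh name for the product, since [(H * K)%type] already carries the
    maximum norm, which comes from no inner product. *)
Definition hilbert_sum (C : numClosedFieldType) (H K : hilbertType C) : Type :=
  (H * K)%type.

Section HilbertSum.
Variables (C : numClosedFieldType) (H K : hilbertType C).
Local Notation W := (hilbert_sum H K).

HB.instance Definition _ := GRing.Lmodule.copy W (H * K)%type.

Definition sum_inner (u v : W) : C := '[u.1, v.1] + '[u.2, v.2].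

Fact sum_inner_bilinear :
  bilinear_for ( *%R : GRing.Scale.law C C)
    (Num.conj \; *%R : GRing.Scale.law C C) sum_inner.
Proof.
split=> [w a u v|w a u v] /=; rewrite /sum_inner /=.
  by rewrite !linearPl/= mulrDr addrACA.
by rewrite !linearPr/= mulrDr addrACA.
Qed.

HB.instance Definition _ := bilinear_isBilinear.Build C W W C
  ( *%R : GRing.Scale.law C C) (Num.conj \; *%R : GRing.Scale.law C C)
  sum_inner sum_inner_bilinear.

Fact sum_inner_hermitian (u v : W) :
  sum_inner u v = (-1) ^+ false * Num.conj (sum_inner v u).
Proof.
rewrite /sum_inner expr0 mul1r rmorphD /=.
by congr (_ + _); exact: inner_conj.
Qed.

HB.instance Definition _ := isHermitianSesquilinear.Build C W false Num.conj
  sum_inner sum_inner_hermitian.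

Fact sum_inner_gt0 (u : W) : u != 0 -> 0 < sum_inner u u.
Proof.
case: u => h k hk0; rewrite lt_def addr_ge0 ?dnorm_ge0// andbT.
apply: contra hk0; rewrite paddr_eq0 ?dnorm_ge0// !dnorm_eq0/=.
by move=> /andP[/eqP-> /eqP->].
Qed.

HB.instance Definition _ := isDotProduct.Build C W sum_inner sum_inner_gt0.

Definition sum_norm (u : W) : C := sqrtC (sum_inner u u).

Fact sum_normD (u v : W) : sum_norm (u + v) <= sum_norm u + sum_norm v.
Proof. exact: dot_triangle. Qed.

Fact sum_normZ (a : C) (u : W) : sum_norm (a *: u) = `|a| * sum_norm u.
Proof.
by rewrite /sum_norm dnormZ sqrtCM ?nnegrE ?exprn_ge0 ?dnorm_ge0// sqrCK.
Qed.

Fact sum_norm_eq0 (u : W) : sum_norm u = 0 -> u = 0.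
Proof. by move=> /eqP; rewrite sqrtC_eq0 dnorm_eq0 => /eqP. Qed.

HB.instance Definition _ := Lmodule_isNormed.Build C W
  sum_normD sum_normZ sum_norm_eq0.

Lemma sqr_sum_norm (u : W) : `|u| ^+ 2 = `|u.1| ^+ 2 + `|u.2| ^+ 2.
Proof. by rewrite [LHS]sqrtCK !sqr_normE. Qed.

Lemma sum_norm_fst (u : W) : `|u.1| <= `|u|.
Proof.
by rewrite -(@ler_pXn2r _ 2)// ?nnegrE// sqr_sum_norm lerDl exprn_ge0.
Qed.

Lemma sum_norm_snd (u : W) : `|u.2| <= `|u|.
Proof.
by rewrite -(@ler_pXn2r _ 2)// ?nnegrE// sqr_sum_norm lerDr exprn_ge0.
Qed.

Lemma sum_norm_le (u : W) : `|u| <= `|u.1| + `|u.2|.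
Proof.
rewrite -(@ler_pXn2r _ 2)// ?nnegrE ?addr_ge0// sqr_sum_norm sqrrD.
by rewrite -addrA lerD2l lerDr mulrn_wge0// mulr_ge0.
Qed.

(** Both projections are contractions, so they send Cauchy filters to Cauchy
    filters; the limit is taken coordinatewise. *)
Fact sum_complete (F : set_system W) : ProperFilter F -> cauchy F -> cvg F.
Proof.
move=> FF Fc.
have cauchy_proj (T : hilbertType C) (g : W -> T) :
  (forall u v, `|g u - g v| <= `|u - v|) -> cvg (g @ F).
  move=> gP; apply: cauchy_cvg; apply/cauchyP => e e0.
  have [u Fu] := (cauchyP _).1 Fc _ e0.
  exists (g u); rewrite /= nbhs_simpl; apply: filterS Fu => v /=.
  rewrite -!ball_normE /ball_ /=; exact: le_lt_trans (gP u v).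
have c1 : cvg ((fst : W -> H) @ F).
  by apply: cauchy_proj => u v; exact: (sum_norm_fst (u - v)).
have c2 : cvg ((snd : W -> K) @ F).
  by apply: cauchy_proj => u v; exact: (sum_norm_snd (u - v)).
apply/cvg_ex; exists (lim ((fst : W -> H) @ F), lim ((snd : W -> K) @ F)).
apply/cvgrPdist_lt => e e0; have e20 : 0 < e / 2 by rewrite divr_gt0.
move/cvgrPdist_lt : c1 => /(_ _ e20) c1.
move/cvgrPdist_lt : c2 => /(_ _ e20) c2.
near=> u; rewrite [e]splitr; apply: le_lt_trans (sum_norm_le _) _.
by rewrite ltrD//=; near: u.
Unshelve. all: by end_near. Qed.

HB.instance Definition _ := Uniform_isComplete.Build W sum_complete.

Fact sum_sqr_normE (u : W) : `|u| ^+ 2 = sum_inner u u.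
Proof. exact: sqrtCK. Qed.

HB.instance Definition _ :=
  CompleteNormedModule_isHilbert.Build C W sum_sqr_normE.

End HilbertSum.

(** * Orthogonal components *)

Lemma inner_CauchySchwarz (C : numClosedFieldType) (H : hilbertType C) (x y : H) :
  `|'[x, y]| <= `|x| * `|y|.
Proof.
rewrite -(@ler_pXn2r _ 2)// ?nnegrE ?mulr_ge0// exprMn !sqr_normE.
exact: dot_CauchySchwarz.
Qed.

Lemma closure_normP (C : numFieldType) (V : normedModType C) (S : set V) (p : V) :
  closure S p <-> forall e, 0 < e -> exists2 s, S s & `|p - s| < e.
Proof.
split=> [clSp e e0|SP U /nbhs_ballP[e /= e0]].
  have [s [Ss]] := clSp _ (nbhsx_ballx p e e0).
  by rewrite -ball_normE; exists s.
rewrite -ball_normE => peU; have [s Ss ps] := SP _ e0.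
by exists s; split=> //; exact: peU.
Qed.

Lemma small_norm_eq0 (C : numFieldType) (V : normedZmodType C) (x : V) (c : C) :
  (forall e, 0 < e -> `|x| <= e * c) -> x = 0.
Proof.
move=> xc; apply/eqP; rewrite -normr_le0.
have c0 : 0 <= c.
  by have := xc _ ltr01; rewrite mul1r; exact: le_trans.
apply/ler_addgt0Pr => e e0; rewrite add0r.
have c1 : 0 < c + 1 by rewrite ltr_wpDl.
apply: (le_trans (xc (e / (c + 1)) (divr_gt0 e0 c1))).
by rewrite -mulrA ler_piMr ?(ltW e0)// mulrC ler_pdivrMr// mul1r lerDl.
Qed.

Definition linear_subspace (C : numFieldType) (V : lmodType C)
    (S : set V) : Prop :=
  S 0 /\ forall (a : C) u v, S u -> S v -> S (a *: u + v).

Lemma subspaceB (C : numFieldType) (V : lmodType C) (S : set V) u v :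
  linear_subspace S -> S u -> S v -> S (u - v).
Proof.
by move=> [S0 SP] Su Sv; rewrite addrC -scaleN1r; exact: SP.
Qed.

Lemma subspaceD (C : numFieldType) (V : lmodType C) (S : set V) u v :
  linear_subspace S -> S u -> S v -> S (u + v).
Proof.
by move=> [S0 SP] Su Sv; rewrite -[u]scale1r; exact: SP.
Qed.

Lemma subspaceZ (C : numFieldType) (V : lmodType C) (S : set V) a u :
  linear_subspace S -> S u -> S (a *: u).
Proof.
by move=> [S0 SP] Su; rewrite -[X in S X]addr0; exact: SP.
Qed.

Section OrthogonalComponent.
Variables (R : realType) (H : hilbertType R[i]).
Local Notation C := R[i].
Implicit Types (S : set H) (x y p q s : H).

Lemma orthogonal_closure S q p :
  (forall s, S s -> '[q, s] = 0) -> closure S p -> '[q, p] = 0.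
Proof.
move=> qS /closure_normP clSp; apply: (@small_norm_eq0 C C^o _ `|q|) => e e0.
have [s Ss /ltW ps] := clSp _ e0.
rewrite -[p](subrK s) linearDr/= (qS s)// addr0 mulrC.
by rewrite (le_trans (inner_CauchySchwarz _ _))// ler_wpM2l.
Qed.

(** Moving from m along s to the best approximation of x on the line m + C s
    lowers the squared distance by |<x - m, s>|^2 / |s|^2, which near
    minimality bounds by e^2. *)
Lemma near_minimizer S x m (d e : C) : linear_subspace S -> S m -> 0 <= e ->
  (forall s, S s -> d <= `|x - s| ^+ 2) -> `|x - m| ^+ 2 <= d + e ^+ 2 ->
  forall s, S s -> `|'[x - m, s]| <= e * `|s|.
Proof.
move=> Ssub Sm e0 dS xm s Ss.
have [->|s0] := eqVneq s 0; first by rewrite linear0r normr0 normr0 mulr0.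
have ss : 0 < '[s, s] by rewrite dnorm_gt0.
pose a := '[x - m, s] / '[s, s]; pose w := (x - m) - a *: s.
have ws : '[w, s] = 0.
  by rewrite linearBl/= linearZl_LR/= divfK ?subrr// gt_eqF.
have was : '[w, a *: s] = 0 by rewrite linearZr_LR/= ws mulr0.
have xmE : `|x - m| ^+ 2 = `|w| ^+ 2 + `|a| ^+ 2 * `|s| ^+ 2.
  by rewrite !sqr_normE -dnormZ -hnormDd// subrK.
have dw : d <= `|w| ^+ 2.
  rewrite /w -addrA -opprD; apply: dS.
  by apply: subspaceD => //; exact: subspaceZ.
have : `|a| ^+ 2 * `|s| ^+ 2 <= e ^+ 2.
  by rewrite -(lerD2l (`|w| ^+ 2)) -xmE (le_trans xm)// lerD2r.
rewrite -exprMn ler_pXn2r ?nnegrE ?mulr_ge0// => ase.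
have -> : '[x - m, s] = a * `|s| ^+ 2 by rewrite sqr_normE divfK// gt_eqF.
by rewrite normrM normrX normr_id expr2 mulrA ler_wpM2r.
Qed.

(** The infimum of the squared distances exists in the real line only, hence
    the passage through real parts. *)
Lemma near_orthogonal S x (e : C) : linear_subspace S -> 0 < e ->
  exists2 m, S m & forall s, S s -> `|'[x - m, s]| <= e * `|s|.
Proof.
move=> Ssub e0; pose D := [set complex.Re (`|x - s| ^+ 2) | s in S].
have normRe (y : H) : `|y| ^+ 2 = (complex.Re (`|y| ^+ 2))%:C%C.
  by rewrite RRe_real// ger0_real// exprn_ge0.
have lbD : lbound D 0.
  by move=> _ [s _ <-]; rewrite -ler0c -normRe exprn_ge0.
have eRe : e ^+ 2 = (complex.Re (e ^+ 2))%:C%C.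
  by rewrite RRe_real// ger0_real// exprn_ge0// ltW.
have e20 : 0 < complex.Re (e ^+ 2).
  by rewrite -(ltcR 0) -eRe exprn_gt0.
have infD : has_inf D.
  by split; [exists (complex.Re (`|x - 0| ^+ 2)), 0 => //; case: Ssub|exists 0].
have [_ [m Sm <-] /ltW xm] := inf_adherent e20 infD.
exists m => //; apply: (@near_minimizer _ _ _ (inf D)%:C%C) => //.
- exact: ltW.
- by move=> s Ss; rewrite normRe lecR; apply: ge_inf; [exists 0|exists s].
- by rewrite normRe eRe -rmorphD lecR.
Qed.

(** The sets [T e] of the points m of S with x - m orthogonal to S up to e
    are nonempty by [near_orthogonal] and decrease with e. Two points m, m' of
    [T e] are at distance at most 2e: test near-orthogonality on s = m - m'.
    So the filter they generate is Cauchy; x minus its limit is the required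
    component. *)
Lemma orthogonal_component_exists S x : linear_subspace S ->
  exists q, closure S (x - q) /\ forall s, S s -> '[q, s] = 0.
Proof.
move=> Ssub.
pose T (e : C) := [set m | S m /\ forall s, S s -> `|'[x - m, s]| <= e * `|s|].
pose F := filter_from [set e : C | 0 < e] T.
have T_le e e' : e <= e' -> T e `<=` T e'.
  move=> ee' m [Sm mP]; split=> // s Ss.
  by rewrite (le_trans (mP _ Ss))// ler_wpM2r.
have FF : ProperFilter F.
  apply: filter_from_proper; last first.
    by move=> e /(near_orthogonal x Ssub)[m Sm mP]; exists m.
  apply: filter_from_filter; first by exists 1; exact: ltr01.
  move=> e e' /= e0 e'0.
  have : e >=< e' by apply: real_comparable; exact: gtr0_real.
  case/orP => ee'.
    by exists e => // m Tm; split=> //; exact: T_le Tm.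
  by exists e' => // m Tm; split=> //; exact: T_le Tm.
have T_near e m m' : 0 < e -> T e m -> T e m' -> `|m - m'| <= e + e.
  move=> e0 [Sm mP] [Sm' m'P].
  have [->|mm'] := eqVneq (m - m') 0; first by rewrite normr0 addr_ge0 ?ltW.
  have Smm' := subspaceB Ssub Sm Sm'.
  rewrite -(@ler_pM2r _ `|m - m'|) ?normr_gt0// -expr2 sqr_normE.
  have mm'E : m - m' = (x - m') - (x - m) by rewrite opprB [RHS]addrC subrKA.
  rewrite -[leLHS]ger0_norm ?dnorm_ge0// {1}mm'E linearBl/= mulrDl.
  by rewrite (le_trans (ler_normB _ _))// lerD// ?mP ?m'P.
have : cvg F.
  apply: cauchy_cvg; apply: cauchy_exP => e e0.
  have e40 : 0 < e / 2 / 2 by rewrite !divr_gt0.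
  have [m Sm mP] := near_orthogonal x Ssub e40.
  exists m; exists (e / 2 / 2) => // m' Tm'; rewrite -ball_normE /ball_/=.
  apply: (le_lt_trans (T_near _ _ _ e40 (conj Sm mP) Tm')).
  by rewrite -splitr [ltRHS]splitr ltrDl divr_gt0.
case/cvg_ex => p Fp; exists (x - p); rewrite subKr.
have near_p e : 0 < e -> exists2 m, T e m & `|p - m| < e.
  move=> e0; have FT : F (T e) by exists e.
  have FB : F (ball p e) by apply: Fp; exact: nbhsx_ballx.
  have [m [Tm]] := filter_ex (filterI FT FB).
  by rewrite -ball_normE; exists m.
split.
  by apply/closure_normP => e /near_p[m [Sm _] pm]; exists m.
move=> s Ss; apply: (@small_norm_eq0 C C^o _ (`|s| + `|s|)) => e e0.
have [m [Sm mP] /ltW pm] := near_p _ e0.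
have -> : x - p = (x - m) - (p - m) by rewrite opprB addrA subrK.
rewrite linearBl/= mulrDr (le_trans (ler_normB _ _))// lerD ?mP//.
by rewrite (le_trans (inner_CauchySchwarz _ _))// ler_wpM2r.
Qed.

End OrthogonalComponent.

Lemma closure_subspace (C : numFieldType) (V : normedModType C) (S : set V) :
  linear_subspace S -> linear_subspace (closure S).
Proof.
move=> Ssub; split; first by apply: subset_closure; exact: (proj1 Ssub).
move=> a u v /closure_normP uS /closure_normP vS.
apply/closure_normP => e e0; have a0 : 0 < `|a| + 1 by rewrite ltr_wpDl.
have e20 : 0 < e / 2 by rewrite divr_gt0.
have [s Ss us] := uS _ (divr_gt0 e20 a0); have [t St vt] := vS _ e20.
exists (a *: s + t); first by case: Ssub => _; exact.
rewrite opprD addrACA -scalerBr [e]splitr (le_lt_trans (ler_normD _ _))//.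
rewrite ler_ltD// normrZ mulrC; move: us; rewrite ltr_pdivlMr// => /ltW.
by apply: le_trans; rewrite ler_wpM2l// lerDl.
Qed.

Section Orthogonal.
Variables (R : realType) (H : hilbertType R[i]).
Local Notation C := R[i].
Implicit Types (S : set H) (x y p q s : H).

(** By [orthogonal_component_exists] and [orth_unique], for a subspace S this is
    x minus its orthogonal projection on the closure of S; the default value
    0 is never taken. *)
Definition orth S x : H :=
  xget 0 [set q | closure S (x - q) /\ forall s, S s -> '[q, s] = 0].

Variable S : set H.
Hypothesis Ssub : linear_subspace S.

Lemma orth_closure x : closure S (x - orth S x).
Proof. by have [] := xgetPex 0 (orthogonal_component_exists x Ssub). Qed.

Lemma orth_orthogonal x s : S s -> '[orth S x, s] = 0.
Proof.
by have [_] := xgetPex 0 (orthogonal_component_exists x Ssub); exact.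
Qed.

Lemma orth_unique x q :
  closure S (x - q) -> (forall s, S s -> '[q, s] = 0) -> orth S x = q.
Proof.
move=> clq qS; apply/eqP; rewrite -subr_eq0 -(dnorm_eq0 inner); apply/eqP.
have dS s : S s -> '[orth S x - q, s] = 0.
  by move=> Ss; rewrite linearBl/= orth_orthogonal// qS// subr0.
have {2}-> : orth S x - q = (x - q) - (x - orth S x).
  by rewrite opprB [RHS]addrC subrKA.
rewrite linearBr/= !(orthogonal_closure dS) ?subr0//; exact: orth_closure.
Qed.

Lemma orth_linear : linear (orth S).
Proof.
move=> a x y; apply: orth_unique.
  rewrite opprD addrACA -scalerBr.
  by apply: (proj2 (closure_subspace Ssub)); exact: orth_closure.
by move=> s Ss; rewrite linearPl/= !orth_orthogonal// mulr0 addr0.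
Qed.

Lemma orth_id d : (forall s, S s -> '[d, s] = 0) -> orth S d = d.
Proof.
move=> dS; apply: orth_unique => //; rewrite subrr.
exact: (proj1 (closure_subspace Ssub)).
Qed.

Lemma orth_self x : '[orth S x, x] = '[orth S x, orth S x].
Proof.
rewrite -{2}[x](subrK (orth S x)) linearDr/=.
rewrite (orthogonal_closure (@orth_orthogonal x)) ?add0r//.
exact: orth_closure.
Qed.

(** Since orth S x is orthogonal to S, |orth S x|^2 = <orth S x, x - s>. *)
Lemma orth_norm_le x s : S s -> `|orth S x| <= `|x - s|.
Proof.
move=> Ss; have [->|q0] := eqVneq (orth S x) 0; first by rewrite normr0.
rewrite -(@ler_pM2l _ `|orth S x|) ?normr_gt0// -expr2 sqr_normE.
apply: le_trans (inner_CauchySchwarz _ _).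
by rewrite linearBr/= (orth_orthogonal x Ss) subr0 orth_self ger0_norm ?dnorm_ge0.
Qed.

End Orthogonal.

(** The constant of a bounded operator may be any complex number when the
    domain is zero; its norm serves equally well. *)
Lemma bounded_ge0 (C : numFieldType) (V W : normedModType C)
    (T : V -> W) (c : C) :
  (forall x, `|T x| <= c * `|x|) -> forall x, `|T x| <= `|c| * `|x|.
Proof.
move=> Tc x; rewrite (le_trans (Tc x))//.
by rewrite -[X in `|c| * X]normr_id -normrM ger0_norm// (le_trans _ (Tc x)).
Qed.

(** * Adjoints *)

Section Adjoint.
Variable R : realType.
Local Notation C := R[i].

(** Unless phi vanishes, the component w orthogonal to the kernel of a vector
    outside it is nonzero, as the kernel is closed; f - (phi f / phi w) w is in
    the kernel, so <f, w> = (phi f / phi w) <w, w>, which gives phi f. *)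
Lemma riesz (H : hilbertType C) (phi : H -> C) (c : C) : scalar phi ->
  (forall f, `|phi f| <= c * `|f|) -> exists x, forall f, phi f = '[f, x].
Proof.
move=> philin /(@bounded_ge0 C H C^o phi c) phic.
have phiB u v : phi (u - v) = phi u - phi v.
  by rewrite addrC -scaleN1r philin mulN1r addrC.
have phi0 : phi 0 = 0 by rewrite -(subrr 0) phiB subrr.
have phiZ a u : phi (a *: u) = a * phi u.
  by rewrite -[a *: u]addr0 philin phi0 addr0.
pose S := [set f : H | phi f = 0].
have Ssub : linear_subspace S.
  by split=> // a u v Su Sv; rewrite /S /= philin Su Sv mulr0 addr0.
have phi_closure p : closure S p -> phi p = 0.
  move=> /closure_normP clSp; apply: (@small_norm_eq0 C C^o _ `|c|) => e e0.
  have [s Ss /ltW ps] := clSp _ e0; rewrite -[phi p]subr0 -Ss -phiB.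
  by rewrite (le_trans (phic _))// mulrC ler_wpM2r.
have [phi_eq0|/existsNP[z /eqP phiz0]] := pselect (forall f, phi f = 0).
  by exists 0 => f; rewrite phi_eq0 linear0r.
pose w := orth S z.
have phiw : phi w = phi z.
  by apply/eqP; rewrite eq_sym -subr_eq0 -phiB phi_closure//; exact: orth_closure.
have ww : '[w, w] != 0.
  by rewrite dnorm_eq0; apply: contra_neq phiz0; rewrite -phiw => ->.
exists (Num.conj (phi w / '[w, w]) *: w) => f.
rewrite linearZr_LR/= conjCK.
have : '[w, f - (phi f / phi w) *: w] = 0.
  apply: (orth_orthogonal Ssub).
  by rewrite /S /= phiB phiZ divfK ?subrr// phiw.
rewrite inner_conj => /eqP; rewrite conjC_eq0 linearBl/= linearZl_LR/=.
rewrite subr_eq0 => /eqP ->.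
by rewrite mulrACA mulVf// mulr1 mulrC divfK// phiw.
Qed.

Lemma eq_inner (H : hilbertType C) (x x' : H) :
  (forall f, '[f, x] = '[f, x']) -> x = x'.
Proof.
move=> xx'; apply/eqP; rewrite -subr_eq0 -(dnorm_eq0 inner) linearBr/= subr_eq0.
exact/eqP/xx'.
Qed.

Lemma adjointP (X Y : hilbertType C) (T : {linear X -> Y}) (y : Y) :
  bounded_operator T -> forall f, '[T f, y] = '[f, adjoint T y].
Proof.
move=> [c /bounded_ge0 Tc].
suff /(xgetPex 0) : exists x : X, forall f : X, '[T f, y] = '[f, x] by [].
apply: (@riesz _ _ (`|c| * `|y|)).
  by move=> a u v; rewrite linearP linearPl.
move=> f; rewrite (le_trans (inner_CauchySchwarz _ _))// mulrAC.
by rewrite ler_wpM2r.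
Qed.

Lemma adjoint_domainP (E H K : hilbertType C) (A : {linear E -> H})
    (B : {linear E -> K}) (k : K) :
  bounded_operator A -> bounded_operator B ->
  adjoint_domain A B k <-> exists h, forall f, '[B f, k] = '[A f, h].
Proof.
move=> bA bB; split=> [[h _ hk]|[h hk]].
  by exists h => f; rewrite !adjointP// hk.
by exists h => //; apply: eq_inner => f; rewrite -!adjointP// hk.
Qed.

End Adjoint.

(** * Dominated operators increasing to B *)

Lemma near_div_nat (R : realType) (x e : R[i]) :
  0 <= x -> 0 < e -> \forall n \near \oo, x / n.+1%:R <= e.
Proof.
move=> x0 e0; pose r := complex.Re x; pose t := complex.Re e.
have xE : x = r%:C%C by rewrite RRe_real ?ger0_real.
have eE : e = t%:C%C by rewrite RRe_real ?gtr0_real.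
have t0 : 0 < t by rewrite -(ltcR 0) -eE.
exists (Num.bound (r / t)) => // n /= Nn.
rewrite ler_pdivrMr// xE eE -(rmorph_nat (real_complex R)) -rmorphM lecR.
rewrite mulrC -ler_pdivrMr//.
have r0 : 0 <= r by rewrite -ler0c -xE.
have := archi_boundP (divr_ge0 r0 (ltW t0)) => /ltW /le_trans; apply.
by rewrite ler_nat leqW.
Qed.

Section Domination.
Variables (R : realType) (E H K : hilbertType R[i]).
Local Notation C := R[i].
Variables (A : {linear E -> H}) (B : {linear E -> K}).

(** The factor is n + 1 rather than n, so that n = 0 gives the relation of the
    pairs (Bg, Ag) itself, which [regular_dense] uses. *)
Definition scaled_relation (n : nat) : set (hilbert_sum K H) :=
  range (fun g : E => (B g, n.+1%:R *: A g) : hilbert_sum K H).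

Lemma scaled_relation_linear_subspace n : linear_subspace (scaled_relation n).
Proof.
split; first by exists 0; rewrite // !linear0.
move=> a _ _ [g _ <-] [g' _ <-]; exists (a *: g + g') => //.
by congr pair; rewrite !linearP.
Qed.

(** Its squared norm is the parallel sum of the forms |Bf|^2 and
    (n + 1)^2 |Af|^2. *)
Definition dominated_part (n : nat) (f : E) : hilbert_sum K H :=
  orth (scaled_relation n) ((B f, 0) : hilbert_sum K H).

Fact dominated_part_linear n : linear (dominated_part n).
Proof.
move=> a f g; rewrite -(orth_linear (scaled_relation_linear_subspace n)).
congr orth; congr pair; first by rewrite linearP.
by rewrite /= scaler0 addr0.
Qed.

HB.instance Definition _ n := GRing.isLinear.Build C E (hilbert_sum K H) *:%R
  (dominated_part n) (dominated_part_linear n).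

Lemma dominated_part_le n f : `|dominated_part n f| <= `|B f|.
Proof.
apply: le_trans (orth_norm_le (scaled_relation_linear_subspace n) _
  (proj1 (scaled_relation_linear_subspace n))) _.
by rewrite subr0 (le_trans (sum_norm_le _))//= normr0 addr0.
Qed.

Lemma dominated_part_dominated n f :
  `|dominated_part n f| <= n.+1%:R * `|A f|.
Proof.
have Sf : scaled_relation n (B f, n.+1%:R *: A f) by exists f.
apply: le_trans (orth_norm_le (scaled_relation_linear_subspace n) _ Sf) _.
rewrite (le_trans (sum_norm_le _))//= subrr normr0 add0r sub0r normrN.
by rewrite normrZ normr_nat.
Qed.

(** The distance from (Bf, 0) to (Bg, N Ag) increases with N for each fixed
    g, hence so does its infimum over g. *)
Lemma dominated_part_mono n f :
  `|dominated_part n f| <= `|dominated_part n.+1 f|.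
Proof.
apply/ler_addgt0Pr => e e0.
pose w : hilbert_sum K H := (B f, 0).
have clw : closure (scaled_relation n.+1) (w - orth (scaled_relation n.+1) w).
  exact: (orth_closure (scaled_relation_linear_subspace n.+1)).
have [_ [g _ <-] qg] := (closure_normP _ _).1 clw _ e0.
have Sg : scaled_relation n (B g, n.+1%:R *: A g) by exists g.
apply: le_trans (orth_norm_le (scaled_relation_linear_subspace n) w Sg) _.
set s : hilbert_sum K H := (B g, n.+2%:R *: A g) in qg.
apply: (@le_trans _ _ `|w - s|).
  rewrite -(@ler_pXn2r _ 2)// ?nnegrE// !sqr_sum_norm/= lerD2l.
  rewrite !sub0r !normrN !normrZ !normr_nat ler_pXn2r ?nnegrE ?mulr_ge0//.
  by rewrite ler_wpM2r// ler_nat.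
have -> : w - s = orth (scaled_relation n.+1) w +
    (w - orth (scaled_relation n.+1) w - s).
  by rewrite addrA [_ + (w - _)]addrC subrK.
by rewrite (le_trans (ler_normD _ _))// lerD2l ltW.
Qed.

(** The vector D = (d, -h / (n + 1)) is orthogonal to the scaled relation, so
    the orthogonal component fixes it, and being a contraction it moves
    w = (Bf, 0) to within |w - D| of D. *)
Lemma dominated_part_ge (n : nat) (f : E) (d : K) (h : H) :
  (forall g, '[B g, d] = '[A g, h]) ->
  `|B f| <= `|dominated_part n f| + (`|B f - d| + `|h| / n.+1%:R) *+ 2.
Proof.
move=> dh; pose w : hilbert_sum K H := (B f, 0).
pose D : hilbert_sum K H := (d, - (n.+1%:R^-1 *: h)).
have Ssub := scaled_relation_linear_subspace n.
have n0 : n.+1%:R != 0 :> C by rewrite pnatr_eq0.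
have DS s : scaled_relation n s -> '[D, s] = 0.
  move=> [g _ <-]; rewrite inner_conj; apply/eqP; rewrite conjC_eq0; apply/eqP.
  rewrite [LHS]/(sum_inner _ _)/= dh linearNr/= linearZl_LR linearZr_LR/=.
  by rewrite fmorphV rmorph_nat mulVKf// subrr.
have wD : `|w - D| <= `|B f - d| + `|h| / n.+1%:R.
  rewrite (le_trans (sum_norm_le _))//= sub0r opprK normrZ normfV normr_nat.
  by rewrite mulrC.
have qE : dominated_part n f = D + orth (scaled_relation n) (w - D).
  rewrite -{1}(orth_id Ssub DS) -[X in X + _]scale1r -orth_linear// scale1r.
  by rewrite addrC subrK.
have q_le : `|orth (scaled_relation n) (w - D)| <= `|w - D|.
  by have := orth_norm_le Ssub (w - D) (proj1 Ssub); rewrite subr0.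
apply: (le_trans (sum_norm_fst w)).
have -> : w = dominated_part n f - orth (scaled_relation n) (w - D) + (w - D).
  by rewrite qE addrK addrC subrK.
rewrite (le_trans (ler_normD _ _))// mulr2n addrA lerD//.
by rewrite (le_trans (ler_normB _ _))// lerD2l (le_trans q_le).
Qed.

Hypotheses (bA : bounded_operator A) (bB : bounded_operator B).

Lemma dense_almost_dominated :
  dense (adjoint_domain A B) -> almost_dominated A B.
Proof.
move=> domd; exists (fun=> hilbert_sum K H), dominated_part, (fun n => n.+1%:R).
split=> //.
- move=> n; have [c Bc] := bB; exists c => f.
  exact: le_trans (dominated_part_le n f) (Bc f).
- move=> f; split=> [n|n|].
  + exact: dominated_part_dominated.
  + exact: dominated_part_mono.
apply/cvgrPdist_le => e e0; have e4 : 0 < e / 2 / 2 by rewrite !divr_gt0.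
have [d [/interior_subset Bfd /(adjoint_domainP _ bA bB)[h dh]]] :
    (ball (B f) (e / 2 / 2))° `&` adjoint_domain A B !=set0.
  apply: domd; last exact: open_interior.
  by exists (B f); exact: nbhsx_ballx.
have {}Bfd : `|B f - d| <= e / 2 / 2 by move: Bfd; rewrite -ball_normE => /ltW.
have := near_div_nat (normr_ge0 h) e4; apply: filterS => n hn.
rewrite ger0_norm ?subr_ge0 ?dominated_part_le// lerBlDl.
apply: le_trans (dominated_part_ge n f dh) _; rewrite lerD2l [leRHS]splitr mulr2n.
by rewrite [e / 2]splitr !lerD.
Qed.
End Domination.

(** * The equivalences *)

Section Equivalence.
Variables (R : realType) (E H K : hilbertType R[i]).
Local Notation C := R[i].
Variables (A : {linear E -> H}) (B : {linear E -> K}).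

Lemma closure_pairP (h : H) (k : K) :
  closure (pair_relation A B) (h, k) <->
  forall e, 0 < e -> exists f, `|h - A f| < e /\ `|k - B f| < e.
Proof.
split=> [clP e e0|P U /nbhs_ballP[e /= e0 eU]].
  have [_ [[f _ <-]]] := clP _ (nbhsx_ballx (h, k) e e0).
  by case=> /=; rewrite -!ball_normE; exists f.
have [f [hf kf]] := P _ e0; exists (A f, B f); split; first by exists f.
by apply: eU; split; rewrite -ball_normE.
Qed.

Lemma closure_pair_linear : linear_relation (closure (pair_relation A B)).
Proof.
apply: closure_subspace; split; first by exists 0; rewrite // !linear0.
move=> a _ _ [f _ <-] [g _ <-]; exists (a *: f + g) => //.
by rewrite !linearP.
Qed.

Lemma regularP : regular_relation (pair_relation A B) <->
  forall k, closure (pair_relation A B) (0, k) -> k = 0.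
Proof.
have [L0 LP] := closure_pair_linear.
split=> [[_ Lop] k Lk|reg]; first exact: Lop Lk L0.
split=> // h k k' Lk Lk'; apply/eqP; rewrite -subr_eq0; apply/eqP/reg.
have := LP (-1) _ _ Lk' Lk; rewrite scaleN1r.
suff -> : - (h, k') + (h, k) = (0, k - k') by [].
by congr pair; rewrite addrC ?subrr.
Qed.

(** The double limit is taken in the order that [approx] shows: an f with Bf
    within e of k has |Bf| <= e, because |B_n f| can be estimated through
    another g with Bg close to k and c_n |Ag| as small as desired. *)
Lemma almost_dominated_regular :
  almost_dominated A B -> regular_relation (pair_relation A B).
Proof.
move=> [K_ [B_ [c [_ c0 domB]]]]; apply/regularP => k /closure_pairP clk.
have u_near f (t : C) : 0 < t -> \forall n \near \oo, `| `|B f| - `|B_ n f| | < t.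
  by move=> t0; have [_ _ /cvgrPdist_lt] := domB f; exact.
have B_le_B n f : `|B_ n f| <= `|B f|.
  have [_ umono _] := domB f.
  apply/ler_addgt0Pr => t /(u_near f)[N _ uN].
  have /uN/= /ltW ut : (N <= maxn N n)%N by exact: leq_maxl.
  have un : `|B_ n f| <= `|B_ (maxn N n) f|.
    elim: (maxn N n) (leq_maxr N n) => [|m IHm]; first by rewrite leqn0 => /eqP->.
    rewrite leq_eqVlt ltnS => /orP[/eqP->//|/IHm].
    by move=> /le_trans; apply; exact: umono.
  rewrite (le_trans un)// -lerBlDl (le_trans _ ut)// distrC.
  by rewrite real_ler_norm// realB.
have approx e f : 0 < e -> `|k - B f| < e -> `|B f| <= e.
  move=> e0 kf.
  have B_le n : `|B_ n f| <= e.
    apply/ler_addgt0Pr => t t0; have c1 : 0 < c n + 1 by rewrite ltr_wpDl.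
    have [g []] := clk _ (divr_gt0 t0 c1).
    rewrite sub0r normrN => /ltW Ag /ltW kg.
    have [dom_f _ _] := domB g.
    have B_fg : `|B_ n (f - g)| <= e + t / (c n + 1).
      rewrite (le_trans (B_le_B _ _))// linearB/=.
      have -> : B f - B g = (k - B g) - (k - B f).
        by rewrite opprB [RHS]addrC subrKA.
      by rewrite (le_trans (ler_normB _ _))// addrC lerD// ltW.
    rewrite -[f](subrK g) linearD (le_trans (ler_normD _ _))//.
    rewrite (le_trans (lerD B_fg (le_trans (dom_f n) (ler_wpM2l (c0 n) Ag))))//.
    rewrite -addrA lerD2l -{1}[t / _]mul1r -mulrDl.
    by rewrite [1 + _]addrC mulrC divfK// gt_eqF.
  apply/ler_addgt0Pr => t /(u_near f)[N _ /(_ N (leqnn N))/= /ltW ut].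
  rewrite -[`|B f|](subrK `|B_ N f|) addrC lerD//.
  by rewrite (le_trans _ ut)// real_ler_norm// realB.
apply: (@small_norm_eq0 C K _ 2) => e e0.
have [f [_ kf]] := clk _ e0.
rewrite -[k](subrK (B f)) (le_trans (ler_normD _ _))// mulr_natr mulr2n.
by rewrite lerD ?approx// ltW.
Qed.

Hypotheses (bA : bounded_operator A) (bB : bounded_operator B).

Lemma adjoint_domain_linear_subspace : linear_subspace (adjoint_domain A B).
Proof.
split; first by apply/adjoint_domainP => //; exists 0 => f; rewrite !linear0r.
move=> a u v /(adjoint_domainP _ bA bB)[h hu] /(adjoint_domainP _ bA bB)[h' hv].
apply/adjoint_domainP => //; exists (a *: h + h') => f.
by rewrite !linearPr/= hu hv.
Qed.

(** For d in the domain, with h as in [adjoint_domainP],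
    <k, d> = <k - Bf, d> + <Af, h>, and both terms can be made small. *)
Lemma dense_regular :
  dense (adjoint_domain A B) -> regular_relation (pair_relation A B).
Proof.
move=> domd; apply/regularP => k /closure_pairP clk.
have orthk d : adjoint_domain A B d -> '[k, d] = 0.
  move=> /(adjoint_domainP _ bA bB)[h dh].
  apply: (@small_norm_eq0 C C^o _ (`|d| + `|h|)) => e e0.
  have [f [Af kf]] := clk _ e0.
  have -> : '[k, d] = '[k - B f, d] + '[A f, h].
    by rewrite -dh -linearDl/= subrK.
  rewrite mulrDr (le_trans (ler_normD _ _))// lerD//.
    by rewrite (le_trans (inner_CauchySchwarz _ _))// ler_wpM2r// ltW.
  rewrite (le_trans (inner_CauchySchwarz _ _))// ler_wpM2r//.
  by move: Af; rewrite sub0r normrN => /ltW.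
apply/eqP; rewrite -(dnorm_eq0 inner); apply/eqP.
apply: (orthogonal_closure orthk); move=> U Uk.
have [d [/interior_subset Ud Dd]] : U° `&` adjoint_domain A B !=set0.
  by apply: domd; [exists k | exact: open_interior].
by exists d.
Qed.

(** The domain is a subspace, so it is dense once only 0 is orthogonal to it;
    this is where a vector (k, 0) is decomposed along the pairs (Bg, Ag). *)
Lemma regular_dense :
  regular_relation (pair_relation A B) -> dense (adjoint_domain A B).
Proof.
move=> /regularP reg.
have orth0 k : (forall d, adjoint_domain A B d -> '[k, d] = 0) -> k = 0.
  move=> kD; apply: reg.
  have Ssub := scaled_relation_linear_subspace A B 0.
  pose S := scaled_relation A B 0; pose w : hilbert_sum K H := (k, 0).
  have q0 : orth S w = 0.
    apply/eqP; rewrite -(dnorm_eq0 inner) -orth_self//.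
    (* The norm squared of the orthogonal component (b, a) is <b, k>. *)
    have := orth_orthogonal Ssub w; rewrite -/S.
    case: (orth S w) => b a qS.
    have /kD kb : adjoint_domain A B b.
      (* <Bg, b> + <Ag, a> = 0 for all g makes -a the vector h for b. *)
      apply/adjoint_domainP => //; exists (- a) => g.
      have /qS : S (B g, 1 *: A g) by exists g.
      rewrite inner_conj => /eqP.
      rewrite conjC_eq0 [X in X == _]/(sum_inner _ _)/=.
      by rewrite scale1r addr_eq0 linearNr => /eqP.
    change ('[b, k] + '[a, 0] == 0).
    by rewrite linear0r addr0 inner_conj kb conjC0.
  have : closure S (w - orth S w) by exact: (orth_closure Ssub).
  rewrite q0 subr0 => /closure_normP clw.
  apply/closure_pairP => e e0; have [_ [f _ <-] wf] := clw _ e0.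
  exists f; split.
    by have := le_lt_trans (sum_norm_snd _) wf; rewrite /= scale1r.
  exact: le_lt_trans (sum_norm_fst _) wf.
move=> U [y Uy] Uo.
have Dsub := adjoint_domain_linear_subspace.
have : closure (adjoint_domain A B) (y - orth (adjoint_domain A B) y).
  exact: (orth_closure Dsub).
have -> : orth (adjoint_domain A B) y = 0.
  by apply: orth0 => d; exact: (orth_orthogonal Dsub).
rewrite subr0 => /(_ U (open_nbhs_nbhs (conj Uo Uy)))[d [Dd Ud]].
by exists d.
Qed.

End Equivalence.

Theorem theorem6p4 (R : realType) (E H K : hilbertType R[i])
    (A : {linear E -> H}) (B : {linear E -> K})
    (bA : bounded_operator A) (bB : bounded_operator B) :
  [<-> almost_dominated A B;
       dense (adjoint_domain A B);
       regular_relation (pair_relation A B)].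
Proof.
tfae.
- by move=> /almost_dominated_regular; exact: regular_dense.
- exact: dense_regular.
- by move=> /(regular_dense bA bB); exact: dense_almost_dominated.
Qed.
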